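(* Consider an instance of the Weight Constrained Shortest Path Problem (directed graph $G=(S,E)$, edge costs $\mathit{cost}_1,\mathit{cost}_2\ge 0$, states $\mathit{start},\mathit{goal}\in S$, weight limit $W$) that admits at least one $\mathit{start}$-$\mathit{goal}$ path $\pi$ with $\mathit{cost}_2(\pi)\le W$. Then the algorithm WC-A* (described in the context) terminates, and the node $\mathit{Sol}$ it returns corresponds to a cost-optimal solution path, i.e. the path obtained by following parent pointers from $\mathit{Sol}$ back to $\mathit{start}$, followed by the path from $s(\mathit{Sol})$ to $\mathit{goal}$ realising $(h_1(s(\mathit{Sol})),ub_2(s(\mathit{Sol})))$, is a cost-optimal solution path.
   Context: A path is a sequence of states $u_1,\dots,u_n$ with $(u_i,u_{i+1})\in E$; $\mathit{cost}_p(\pi)=\sum_i \mathit{cost}_p(u_i,u_{i+1})$ for $p\in\{1,2\}$. A cost-optimal solution path is a $\mathit{start}$-$\mathit{goal}$ path $\pi^*$ with $\mathit{cost}_2(\pi^* )\le W$ whose pair $(\mathit{cost}_1,\mathit{cost}_2)$ is lexicographically smallest among all $\mathit{start}$-$\mathit{goal}$ paths with $\mathit{cost}_2\le W$. WC-A*, initialisation: set $\overline{f_2}=W$, $\overline{f_1}=\infty$. (i) Run a bounded A* search backward from $\mathit{goal}$ (on the reversed graph) on $\mathit{cost}_2$ with an admissible heuristic, breaking ties on $\mathit{cost}_1$; for every state $u$ it expands it records $h_2(u)$ = minimum $\mathit{cost}_2$ of a $u$-$\mathit{goal}$ path and $ub_1(u)$ = the $\mathit{cost}_1$ of a $u$-$\mathit{goal}$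 path that is lexicographically minimal in $(\mathit{cost}_2,\mathit{cost}_1)$; when $\mathit{start}$ is about to be expanded it sets $\overline{f_1}\leftarrow ub_1(\mathit{start})$; it stops before expanding a state whose $f_2$-estimate exceeds $\overline{f_2}$. (ii) Then run a bounded backward A* from $\mathit{goal}$ on $\mathit{cost}_1$ with an admissible heuristic, breaking ties on $\mathit{cost}_2$, using only states expanded in (i); for each state $u$ it expands it records $h_1(u)$ = minimum $\mathit{cost}_1$ of a $u$-$\mathit{goal}$ path and $ub_2(u)$ = the $\mathit{cost}_2$ of such a path lexicographically minimal in $(\mathit{cost}_1,\mathit{cost}_2)$; it stops before expanding a state with $f_1$-estimate exceeding $\overline{f_1}$. States not explored in these searches are ignored in what follows. WC-A*, constrained search: a node $x$ stores a state $s(x)$, $\mathbf g(x)=(g_1(x),g_2(x))$ (costs of the path from $\mathit{start}$ to $s(x)$ given by its parent pointers), $\mathbf f(x)=\mathbf g(x)+\mathbf h(s(x))$, and a parent. Initialise $g_{min}(u)=\infty$ for all $u$, $f^{sol}_2=\infty$, $\mathit{Sol}$ empty, and a priority queue $\mathit{Open}$ containing the node for $\mathit{start}$ with $\mathbf g=(0,0)$. While $\mathit{Open}\ne\emptyset$: remove from $\mathit{Open}$ a node $x$ with lexicographically smallest $(f_1,f_2)$; if $f_1(x)>\overline{f_1}$ stop; if $g_2(x)\ge g_{min}(s(x))$ discard $x$ and continue; set $g_{min}(s(x))\leftarrow g_2(x)$. (Early solution update) Let $u=s(x)$, $f_1'=g_1(x)+ub_1(u)$, $f_2'=g_2(x)+ub_2(u)$.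 If $f_2'\le\overline{f_2}$: if $f_1(x)<\overline{f_1}$ or $f_2'<f^{sol}_2$, set $\overline{f_1}\leftarrow f_1(x)$, $f^{sol}_2\leftarrow f_2'$, $\mathit{Sol}\leftarrow x$. Otherwise, if $f_1'<\overline{f_1}$, set $\overline{f_1}\leftarrow f_1'$ and $f^{sol}_2\leftarrow\infty$. If $h_1(u)=ub_1(u)$, continue without expanding. Otherwise, for every edge $(u,v)\in E$ create node $y$ with $s(y)=v$, $\mathbf g(y)=\mathbf g(x)+\mathbf{cost}(u,v)$, $\mathbf f(y)=\mathbf g(y)+\mathbf h(v)$, parent $x$; discard $y$ if $g_2(y)\ge g_{min}(v)$, or $f_1(y)>\overline{f_1}$, or $f_2(y)>\overline{f_2}$; otherwise insert $y$ into $\mathit{Open}$. When the loop ends, return $\mathit{Sol}$. *)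

(* Defs.v *)
From HB Require Import structures.
From mathcomp Require Import all_boot all_order all_algebra.
From mathcomp Require Import constructive_ereal.
Set Implicit Arguments. Unset Strict Implicit. Unset Printing Implicit Defensive.
Import Order.TTheory GRing.Theory Num.Theory.
Local Open Scope ring_scope.
Local Open Scope ereal_scope.

Section WCAstar.
Variables (R : realDomainType) (S : finType) (E : rel S) (c1 c2 : S -> S -> R).

Fixpoint pcost (c : S -> S -> R) (u : S) (p : seq S) : R :=
  match p with [::] => 0%R | v :: p' => (c u v + pcost c v p')%R end.

Definition gpath (A : {set S}) (u : S) (p : seq S) (t : S) : bool :=
  [&& path E u p, last u p == t & all (mem A) (u :: p)].

Definition lexle (a b : R * R) : bool :=
  ((a.1 < b.1)%R || ((a.1 == b.1) && (a.2 <= b.2)%R)).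

Definition cost_optimal (start goal : S) (W : R) (p : seq S) : Prop :=
  [/\ gpath setT start p goal, (pcost c2 start p <= W)%R &
      forall q, gpath setT start q goal -> (pcost c2 start q <= W)%R ->
        lexle (pcost c1 start p, pcost c2 start p)
              (pcost c1 start q, pcost c2 start q)].

(* Outcome of the two backward searches, given the heuristics hh2 (phase (i),
   estimating cost_2 from start) and hh1 (phase (ii), estimating cost_1 from
   start): explored sets X1, X2 and the recorded values h1 h2 ub1 ub2. *)
Definition init_outcome (start goal : S) (W : R) (hh2 hh1 : S -> R)
    (X1 X2 : {set S}) (h1 h2 ub1 ub2 : S -> R) : Prop :=
  [/\ (* phase (i): h2 u = min cost_2, ub1 u = cost_1 of a (cost2,cost1)-lexmin path *)
      (forall u, (exists p, gpath setT u p goal) ->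
        exists2 p, gpath setT u p goal &
          [/\ h2 u = pcost c2 u p, ub1 u = pcost c1 u p &
              forall q, gpath setT u q goal ->
                lexle (pcost c2 u p, pcost c1 u p) (pcost c2 u q, pcost c1 u q)]),
      (* states expanded in phase (i): f2-estimate within the bound W *)
      (forall u, u \in X1 <-> (exists p, gpath setT u p goal) /\ (h2 u + hh2 u <= W)%R),
      (* phase (ii), on the subgraph of states expanded in (i) *)
      (forall u, (exists p, gpath X1 u p goal) ->
        exists2 p, gpath X1 u p goal &
          [/\ h1 u = pcost c1 u p, ub2 u = pcost c2 u p &
              forall q, gpath X1 u q goal ->
                lexle (pcost c1 u p, pcost c2 u p) (pcost c1 u q, pcost c2 u q)]) &
      (* states expanded in phase (ii): f1-estimate within the bound f1bar
         set in phase (i) (ub1 start if start was expanded, else +oo) *)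
      (forall u, u \in X2 <-> [/\ u \in X1, (exists p, gpath X1 u p goal) &
          ((h1 u + hh1 u)%:E <= (if start \in X1 then (ub1 start)%:E else +oo))])].

(* A node is represented by the list x of states following start along its
   parent pointers: the path of the node is start :: x. *)
Record config := Config {
  cOpen : seq (seq S);
  cgmin : S -> \bar R;
  cf1b : \bar R;
  cfsol2 : \bar R;
  cSol : option (seq S);
  chalted : bool }.

Variables (start goal : S) (W : R) (X1 X2 : {set S}) (h1 h2 ub1 ub2 : S -> R).

Definition nstate (x : seq S) : S := last start x.
Definition ng1 (x : seq S) : R := pcost c1 start x.
Definition ng2 (x : seq S) : R := pcost c2 start x.
Definition nf1 (x : seq S) : R := (ng1 x + h1 (nstate x))%R.
Definition nf2 (x : seq S) : R := (ng2 x + h2 (nstate x))%R.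

Definition init_config : config :=
  Config [:: [::]] (fun _ => +oo)
         (if start \in X1 then (ub1 start)%:E else +oo) +oo None false.

Definition terminal (c : config) : bool := chalted c || nilp (cOpen c).

Definition early_update (x : seq S) (f1b fs : \bar R) (sol : option (seq S))
    : \bar R * \bar R * option (seq S) :=
  let u := nstate x in
  let f1' := (ng1 x + ub1 u)%R in
  let f2' := (ng2 x + ub2 u)%R in
  if (f2' <= W)%R then
    (if ((nf1 x)%:E < f1b) || (f2'%:E < fs) then ((nf1 x)%:E, f2'%:E, Some x)
     else (f1b, fs, sol))
  else if f1'%:E < f1b then (f1'%:E, +oo, sol) else (f1b, fs, sol).

Definition gmin_upd (gm : S -> \bar R) (x : seq S) : S -> \bar R :=
  fun w => if w == nstate x then (ng2 x)%:E else gm w.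

(* children of x that are inserted into Open (states not explored in the
   initialisation, i.e. outside X2, are ignored) *)
Definition children (gm : S -> \bar R) (f1b : \bar R) (x : seq S) : seq (seq S) :=
  [seq rcons x v | v <- enum S &
     [&& E (nstate x) v, v \in X2,
         (ng2 (rcons x v))%:E < gm v,
         (nf1 (rcons x v))%:E <= f1b &
         (nf2 (rcons x v) <= W)%R]].

(* One iteration of the while loop, removing node x from Open (any node with
   lexicographically smallest (f1,f2): ties are broken arbitrarily). *)
Inductive step : config -> config -> Prop :=
| step_stop : forall O gm f1b fs sol x,
    x \in O -> (forall y, y \in O -> lexle (nf1 x, nf2 x) (nf1 y, nf2 y)) ->
    f1b < (nf1 x)%:E ->
    step (Config O gm f1b fs sol false) (Config (rem x O) gm f1b fs sol true)
| step_discard : forall O gm f1b fs sol x,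
    x \in O -> (forall y, y \in O -> lexle (nf1 x, nf2 x) (nf1 y, nf2 y)) ->
    (nf1 x)%:E <= f1b ->
    gm (nstate x) <= (ng2 x)%:E ->
    step (Config O gm f1b fs sol false) (Config (rem x O) gm f1b fs sol false)
| step_process : forall O gm f1b fs sol x f1b' fs' sol',
    x \in O -> (forall y, y \in O -> lexle (nf1 x, nf2 x) (nf1 y, nf2 y)) ->
    (nf1 x)%:E <= f1b ->
    (ng2 x)%:E < gm (nstate x) ->
    early_update x f1b fs sol = (f1b', fs', sol') ->
    step (Config O gm f1b fs sol false)
         (Config (if h1 (nstate x) == ub1 (nstate x) then rem x O
                  else rem x O ++ children (gmin_upd gm x) f1b' x)
                 (gmin_upd gm x) f1b' fs' sol' false).

Inductive reachable : config -> Prop :=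
| reach_init : reachable init_config
| reach_step : forall c c', reachable c -> step c c' -> reachable c'.

End WCAstar.

(* Main.v *)
Require Import Defs.
From HB Require Import structures.
From mathcomp Require Import all_boot all_order all_algebra.
From mathcomp Require Import constructive_ereal.
From Stdlib Require Import Classical_Prop.
Import Order.TTheory GRing.Theory Num.Theory.
Local Open Scope ring_scope.
Set Implicit Arguments. Unset Strict Implicit. Unset Printing Implicit Defensive.

(* Fix a cost-optimal solution path with costs (a, b), and call a search node
   good when some continuation to the goal makes it no more expensive than
   that path in both costs.  No state of such a completion is pruned by the
   backward searches, the f1-bound never drops below a, and a good node x
   satisfies (f1 x, g2 x + ub2 (s x)) <=lex (a, b), so its early update makes
   Sol optimal as soon as g2 x + ub2 (s x) <= W.  The invariant is that, until Sol is optimal in this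
   sense, Open holds a live good node (one whose g2 still beats g_min at its
   state).  Expanding a good node x either makes it Sol, or passes goodness
   to a live child, or the child is dominated by an earlier expansion at the
   same state, which has a live good descendant with a shorter continuation;
   if that descendant dies at x, x itself is good with the shorter
   continuation, and we conclude by induction on its length.  The search
   terminates because every expansion lowers g_min at some state and thereby
   kills a live simple path, while every discard shrinks Open. *)

Section Paths.
Variables (R : realDomainType) (S : finType) (E : rel S).
Implicit Types (c : S -> S -> R) (u v w t : S) (p q : seq S) (A B : {set S}).

Lemma pcost_cat c u p q : pcost c u (p ++ q) = pcost c u p + pcost c (last u p) q.
Proof. by elim: p u => [|v p IH] u /=; rewrite ?add0r // IH addrA. Qed.

Lemma pcost_rcons c u p v : pcost c u (rcons p v) = pcost c u p + c (last u p) v.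
Proof. by rewrite -cats1 pcost_cat /= addr0. Qed.

Lemma pcost_ge0 c : (forall u v, E u v -> 0 <= c u v) ->
  forall u p, path E u p -> 0 <= pcost c u p.
Proof.
move=> c_ge0 u p; elim: p u => [|v p IH] u //= /andP[Euv Ep].
by rewrite addr_ge0 ?c_ge0 ?IH.
Qed.

Lemma pcost_take_le c u p i : (forall u v, E u v -> 0 <= c u v) ->
  path E u p -> pcost c u (take i p) <= pcost c u p.
Proof.
move=> c_ge0; rewrite -{1 3}(cat_take_drop i p) cat_path pcost_cat.
by case/andP=> _ /(pcost_ge0 c_ge0); rewrite lerDl.
Qed.

Lemma gpathP A u p t :
  reflect [/\ path E u p, last u p = t & all (mem A) (u :: p)] (gpath E A u p t).
Proof. by apply: (iffP and3P) => -[? /eqP ? ?]. Qed.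

Lemma gpathT u p t : gpath E setT u p t <-> path E u p /\ last u p = t.
Proof.
split=> [/gpathP[] //|[Ep Et]]; apply/gpathP; split=> //.
by apply/allP => w _; rewrite /= inE.
Qed.

Lemma gpath_restrict A u p t :
  gpath E setT u p t -> all (mem A) (u :: p) -> gpath E A u p t.
Proof. by case/gpathT => Ep Et pA; apply/gpathP. Qed.

Lemma gpath_sub A B u p t : {subset A <= B} -> gpath E A u p t -> gpath E B u p t.
Proof.
move=> sAB /gpathP[Ep Et pA]; apply/gpathP; split=> //.
by apply/allP => w /(allP pA); apply: sAB.
Qed.

Lemma gpath_setT A u p t : gpath E A u p t -> gpath E setT u p t.
Proof. by apply: gpath_sub => w; rewrite inE. Qed.

Lemma gpath_cat A u p q t :
  gpath E A u (p ++ q) t <-> gpath E A u p (last u p) /\ gpath E A (last u p) q t.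
Proof.
have last_in : all (mem A) (u :: p) -> last u p \in A.
  by move/allP; apply; apply: mem_last.
split.
  case/gpathP; rewrite cat_path last_cat -cat_cons all_cat.
  case/andP=> Ep Eq Et /andP[pA qA].
  by split; apply/gpathP; split; rewrite //= ?last_in.
case=> /gpathP[Ep _ pA] /gpathP[Eq Et] /= /andP[_ qA].
by apply/gpathP; rewrite cat_path last_cat -cat_cons all_cat Ep Eq pA qA.
Qed.

Lemma gpath_cons A u v p t :
  gpath E A u (v :: p) t <-> [/\ E u v, u \in A & gpath E A v p t].
Proof.
split.
  by case/gpathP=> /= /andP[Euv Ep] Et /andP[uA vpA]; split=> //; apply/gpathP.
by case=> Euv uA /gpathP[Ep Et vpA]; apply/gpathP; rewrite /= Euv Ep uA.
Qed.

Lemma gpath_catT u y p t :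
  path E u y -> gpath E setT (last u y) p t -> gpath E setT u (y ++ p) t.
Proof. by move=> Ey p_sol; apply/gpath_cat; split=> //; apply/gpathT. Qed.

Lemma gpath_suffix A u y p t : path E u y -> gpath E setT (last u y) p t ->
  all (mem A) (u :: y ++ p) -> gpath E A (last u y) p t.
Proof.
move=> Ey p_sol; rewrite -cat_cons all_cat => /andP[yA pA].
by apply: gpath_restrict; rewrite //= pA andbT; apply: (allP yA); apply: mem_last.
Qed.

Lemma mem_path_split w u p : w \in u :: p ->
  exists p1 p2, p = p1 ++ p2 /\ last u p1 = w.
Proof.
rewrite in_cons => /orP[/eqP ->|]; first by exists [::], p.
by case/splitPr => p1 p2; exists (rcons p1 w), p2; rewrite cat_rcons last_rcons.
Qed.

Lemma mem_path_last_take w u p : w \in u :: p ->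
  exists2 i, (i <= size p)%N & last u (take i p) = w.
Proof.
elim: p u => [|v p IH] u; first by rewrite mem_seq1 => /eqP ->; exists 0%N.
rewrite in_cons => /orP[/eqP ->|/IH[i lei <-]]; first by exists 0%N.
by exists i.+1.
Qed.

Lemma uniq_path_size_lt_card u p : uniq (u :: p) -> (size p < #|S|)%N.
Proof. by move/card_uniqP; have := max_card (mem (u :: p)) => /[swap] ->. Qed.

Lemma simple_path_le u p t : path E u p -> last u p = t -> exists q,
  [/\ path E u q, last u q = t, uniq (u :: q) &
      forall c, (forall a b, E a b -> 0 <= c a b) -> pcost c u q <= pcost c u p].
Proof.
elim: p u => [|v p IH] u; first by move=> _ Ht; exists [::].
case/andP=> Euv Ep Ht; have [q [Eq Hqt qU q_le]] := IH v Ep Ht.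
have le_cons c : (forall a b, E a b -> 0 <= c a b) ->
    pcost c u (v :: q) <= pcost c u (v :: p).
  by move=> c_ge0; rewrite /= lerD2l q_le.
have [uq|uNq] := boolP (u \in v :: q); last first.
  by exists (v :: q); split; rewrite /= ?Euv ?uNq.
have [p1 [p2 defvq]] : exists p1 p2, v :: q = p1 ++ u :: p2.
  by case/splitPr: uq => p1 p2; exists p1, p2.
have : path E u (p1 ++ u :: p2) by rewrite -defvq /= Euv.
rewrite cat_path /= => /and3P[Ep1 Elast Ep2].
exists p2; split=> //.
- by rewrite -Hqt -(last_cons u v q) defvq last_cat.
- by move: qU; rewrite defvq cat_uniq => /and3P[].
- move=> c c_ge0; apply: le_trans (le_cons c c_ge0).
  rewrite defvq pcost_cat /= addrA lerDr.
  by rewrite addr_ge0 ?(pcost_ge0 c_ge0) ?c_ge0.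
Qed.

Fixpoint seqs_upto (n : nat) : seq (seq S) :=
  if n is n'.+1 then [::] :: [seq v :: s | v <- enum S, s <- seqs_upto n']
  else [:: [::]].

Lemma mem_seqs_upto n s : (size s <= n)%N -> s \in seqs_upto n.
Proof.
elim: n s => [|n IH] [|v s] //=; rewrite ?mem_head // ltnS => Hs.
by rewrite in_cons (allpairs_f (fun v s => v :: s)) ?orbT ?mem_enum ?IH.
Qed.

End Paths.

Section Lexicographic.
Variable R : realDomainType.
Implicit Types a b d : R * R.

Lemma lexle_refl a : lexle a a.
Proof. by rewrite /lexle eqxx lexx orbT. Qed.

Lemma lexle_le1 a b : lexle a b -> a.1 <= b.1.
Proof. by case/orP=> [/ltW|/andP[/eqP -> _]]. Qed.

Lemma lexle_le2 a b : lexle a b -> a.1 = b.1 -> a.2 <= b.2.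
Proof. by case/orP=> [lt_ab eq_ab|/andP[_ ->]] //; rewrite eq_ab ltxx in lt_ab. Qed.

Lemma lexleI a b : a.1 <= b.1 -> (a.1 = b.1 -> a.2 <= b.2) -> lexle a b.
Proof.
rewrite /lexle le_eqVlt => /orP[/eqP eq_ab le2|->] //.
by rewrite (le2 eq_ab) eq_ab eqxx orbT.
Qed.

Lemma lexle_trans b a d : lexle a b -> lexle b d -> lexle a d.
Proof.
move=> le_ab le_bd; have le1_ab := lexle_le1 le_ab; have le1_bd := lexle_le1 le_bd.
apply: lexleI => [|eq_ad]; first exact: le_trans le1_bd.
have eq_ab : a.1 = b.1 by apply/eqP; rewrite eq_le le1_ab eq_ad.
have eq_bd : b.1 = d.1 by rewrite -eq_ad eq_ab.
exact: le_trans (lexle_le2 le_ab eq_ab) (lexle_le2 le_bd eq_bd).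
Qed.

Lemma lexle_total a b : lexle a b || lexle b a.
Proof.
rewrite /lexle; case: (ltgtP a.1 b.1) => //= _.
by rewrite le_total.
Qed.

Lemma exists_lexle_min (T : eqType) (k : T -> R * R) (s : seq T) : s != [::] ->
  exists2 x, x \in s & forall y, y \in s -> lexle (k x) (k y).
Proof.
elim: s => [|a s IH] // _; have [->|/IH[x xs x_min]] := eqVneq s [::].
  by exists a => [|y]; rewrite ?mem_seq1 // => /eqP ->; apply: lexle_refl.
have [le_ax|le_xa] := orP (lexle_total (k a) (k x)).
  exists a => [|y]; rewrite ?mem_head // in_cons => /orP[/eqP ->|ys].
    exact: lexle_refl.
  exact: lexle_trans le_ax (x_min y ys).
exists x => [|y]; rewrite in_cons ?xs ?orbT // => /orP[/eqP -> //|/x_min //].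
Qed.

End Lexicographic.

Lemma count_lt_subpred (T : eqType) (a b : pred T) (s : seq T) y :
  subpred a b -> y \in s -> b y -> ~~ a y -> (count a s < count b s)%N.
Proof.
move=> sub_ab; elim: s => [|z s IH] //; rewrite in_cons /= => /orP[/eqP <-|ys] yb yNa.
  by rewrite yb (negbTE yNa) add0n add1n ltnS sub_count.
rewrite -addnS leq_add ?IH //.
by case az: (a z) => //; rewrite (sub_ab _ az).
Qed.

Lemma no_lex_descent (m n : nat -> nat) :
  ~ (forall k, m k.+1 < m k \/ m k.+1 <= m k /\ n k.+1 < n k)%N.
Proof.
move=> descent.
suff bounded a b k : (m k < a)%N -> (n k < b)%N -> False by exact: (bounded _ _ 0%N).
elim: a b k => [|a IHa] // b; elim: b => [|b IHb] k // lt_ma lt_nb.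
case: (descent k) => [lt_m|[le_m lt_n]].
  by apply: (IHa (n k.+1).+1 k.+1) => //; apply: leq_trans lt_m _; rewrite -ltnS.
by apply: (IHb k.+1); [exact: leq_ltn_trans lt_ma | apply: leq_trans lt_n _; rewrite -ltnS].
Qed.

Section Instance.
Variables (R : realDomainType) (S : finType) (E : rel S)
    (c1 c2 : S -> S -> R) (start goal : S) (W : R).
Hypothesis c1_ge0 : forall u v, E u v -> 0 <= c1 u v.
Hypothesis c2_ge0 : forall u v, E u v -> 0 <= c2 u v.
Hypothesis feasible : exists p, gpath E setT start p goal /\ pcost c2 start p <= W.
Variables (hh2 hh1 : S -> R) (X1 X2 : {set S}) (h1 h2 ub1 ub2 : S -> R).
Hypothesis hh2_adm : forall u p, gpath E setT start p u -> hh2 u <= pcost c2 start p.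
Hypothesis hh1_adm : forall u p, gpath E X1 start p u -> hh1 u <= pcost c1 start p.
Hypothesis init : init_outcome E c1 c2 start goal W hh2 hh1 X1 X2 h1 h2 ub1 ub2.
Implicit Types (u v : S) (p q : seq S).

Lemma exists_cost_optimal : exists ps, cost_optimal E c1 c2 start goal W ps.
Proof.
pose sols := [seq p <- seqs_upto S #|S| |
               gpath E setT start p goal && (pcost c2 start p <= W)].
have simple_sol q : gpath E setT start q goal -> pcost c2 start q <= W ->
    exists2 p, p \in sols &
      pcost c1 start p <= pcost c1 start q /\ pcost c2 start p <= pcost c2 start q.
  case/gpathT=> Eq qt qW; have [p [Ep pt pU p_le]] := simple_path_le R Eq qt.
  have [le1 le2] := (p_le _ c1_ge0, p_le _ c2_ge0).
  have p_sol : gpath E setT start p goal by apply/gpathT.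
  exists p => //; rewrite mem_filter p_sol (le_trans le2 qW) mem_seqs_upto //.
  exact: ltnW (uniq_path_size_lt_card pU).
have [p0 [p0_sol p0W]] := feasible; have [p p_sols _] := simple_sol _ p0_sol p0W.
have /(exists_lexle_min (fun p => (pcost c1 start p, pcost c2 start p))) : sols != [::].
  by apply/eqP => sols0; rewrite sols0 in p_sols.
case=> ps; rewrite mem_filter => /andP[/andP[ps_sol psW] _] ps_min.
exists ps; split=> // q q_sol qW; have [p' p'_sols [le1 le2]] := simple_sol q q_sol qW.
by apply: lexle_trans (ps_min p' p'_sols) _; apply: lexleI.
Qed.

Lemma h2_ub1_path u p0 : gpath E setT u p0 goal -> exists2 p, gpath E setT u p goal &
  [/\ h2 u = pcost c2 u p, ub1 u = pcost c1 u p &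
      forall q, gpath E setT u q goal ->
        lexle (pcost c2 u p, pcost c1 u p) (pcost c2 u q, pcost c1 u q)].
Proof. by case: init => spec _ _ _ p0_sol; apply: spec; exists p0. Qed.

Lemma h1_ub2_path u p0 : gpath E X1 u p0 goal -> exists2 p, gpath E X1 u p goal &
  [/\ h1 u = pcost c1 u p, ub2 u = pcost c2 u p &
      forall q, gpath E X1 u q goal ->
        lexle (pcost c1 u p, pcost c2 u p) (pcost c1 u q, pcost c2 u q)].
Proof. by case: init => _ _ spec _ p0_sol; apply: spec; exists p0. Qed.

Lemma mem_X1 u : u \in X1 <-> (exists p, gpath E setT u p goal) /\ h2 u + hh2 u <= W.
Proof. by case: init. Qed.

Lemma mem_X2 u : u \in X2 <-> [/\ u \in X1, (exists p, gpath E X1 u p goal) &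
  ((h1 u + hh1 u)%:E <= (if start \in X1 then (ub1 start)%:E else +oo))%E].
Proof. by case: init. Qed.

Lemma X2_sub_X1 : {subset X2 <= X1}.
Proof. by move=> u /mem_X2[]. Qed.

Lemma h2_min u q : gpath E setT u q goal -> h2 u <= pcost c2 u q.
Proof. by move=> q_sol; have [p _ [-> _ p_min]] := h2_ub1_path q_sol; apply: lexle_le1 (p_min q q_sol). Qed.

Lemma h1_min u q : gpath E X1 u q goal -> h1 u <= pcost c1 u q.
Proof. by move=> q_sol; have [p _ [-> _ p_min]] := h1_ub2_path q_sol; apply: lexle_le1 (p_min q q_sol). Qed.

Lemma ub2_min u q : gpath E X1 u q goal -> pcost c1 u q = h1 u -> ub2 u <= pcost c2 u q.
Proof.
move=> q_sol q1; have [p _ [h1E -> p_min]] := h1_ub2_path q_sol.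
by apply: (lexle_le2 (p_min q q_sol)); rewrite /= q1.
Qed.

Lemma X2_h1_path u : u \in X2 -> exists2 p, gpath E X1 u p goal &
  h1 u = pcost c1 u p /\ ub2 u = pcost c2 u p.
Proof. by case/mem_X2=> _ [p0 /h1_ub2_path[p p_sol [? ? _]]] _; exists p. Qed.

Lemma X2_h2_path u : u \in X2 -> exists2 p, gpath E setT u p goal &
  h2 u = pcost c2 u p /\ ub1 u = pcost c1 u p.
Proof. by case/mem_X2=> _ [p0 /gpath_setT/h2_ub1_path[p p_sol [? ? _]]] _; exists p. Qed.

Lemma h1_ge0 u : u \in X2 -> 0 <= h1 u.
Proof. by case/X2_h1_path=> p /gpathP[Ep _ _] [-> _]; apply: (pcost_ge0 c1_ge0). Qed.

Lemma h1_edge u v : u \in X1 -> v \in X2 -> E u v -> h1 u <= c1 u v + h1 v.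
Proof.
move=> uX1 /X2_h1_path[p p_sol [-> _]] Euv.
by apply: (@h1_min u (v :: p)); apply/gpath_cons.
Qed.

Lemma solution_in_X1 p : gpath E setT start p goal -> pcost c2 start p <= W ->
  all (mem X1) (start :: p).
Proof.
move=> p_sol pW; apply/allP => w /mem_path_split[p1 [p2 [defp p1w]]]; subst p.
case/gpath_cat: p_sol; rewrite p1w => p1_sol p2_sol.
apply/mem_X1; split; first by exists p2.
rewrite pcost_cat p1w in pW; apply: le_trans pW.
by rewrite addrC lerD ?hh2_adm ?h2_min.
Qed.

Lemma solution_in_X2 p : gpath E setT start p goal -> pcost c2 start p <= W ->
  pcost c1 start p <= ub1 start -> all (mem X2) (start :: p).
Proof.
move=> p_sol pW p_ub1; have pX1 := solution_in_X1 p_sol pW.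
have startX1 : start \in X1 by case/andP: pX1.
apply/allP => w /mem_path_split[p1 [p2 [defp p1w]]].
move: pX1 p_sol; rewrite defp -cat_cons all_cat => /andP[p1X1 p2X1].
case/gpath_cat; rewrite p1w => p1_sol p2_sol.
have wX1 : w \in X1 by rewrite -p1w; apply: (allP p1X1); apply: mem_last.
have p1_solX1 : gpath E X1 start p1 w by apply: gpath_restrict.
have p2_solX1 : gpath E X1 w p2 goal by apply: gpath_restrict; rewrite //= wX1.
apply/mem_X2; split=> //; first by exists p2.
rewrite startX1 lee_fin; rewrite defp pcost_cat p1w in p_ub1; apply: le_trans p_ub1.
by rewrite addrC lerD ?hh1_adm ?h1_min.
Qed.

Lemma solution_suffix_in_X1 y p :
  path E start y -> gpath E setT (nstate start y) p goal ->
  pcost c2 start (y ++ p) <= W -> gpath E X1 (nstate start y) p goal.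
Proof.
move=> Ey p_sol yW; apply: gpath_suffix => //.
exact: solution_in_X1 (gpath_catT Ey p_sol) yW.
Qed.

Lemma ub2_le_suffix y p :
  path E start y -> gpath E setT (nstate start y) p goal ->
  pcost c2 start (y ++ p) <= W -> pcost c1 (nstate start y) p = h1 (nstate start y) ->
  ub2 (nstate start y) <= pcost c2 (nstate start y) p.
Proof. by move=> Ey p_sol yW; apply: ub2_min; apply: solution_suffix_in_X1. Qed.

Lemma start_solution : exists p, [/\ gpath E setT start p goal,
  pcost c2 start p <= W & pcost c1 start p = ub1 start].
Proof.
have [p0 [p0_sol p0W]] := feasible.
have [p p_sol [h2E ub1E _]] := h2_ub1_path p0_sol; exists p; split=> //.
by rewrite -h2E (le_trans _ p0W) ?h2_min.
Qed.

Lemma start_X1 : start \in X1.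
Proof. by have [p [p_sol pW _]] := start_solution; case/andP: (solution_in_X1 p_sol pW). Qed.

Lemma start_X2 : start \in X2.
Proof.
have [p [p_sol pW pub1]] := start_solution.
have p_ub1 : pcost c1 start p <= ub1 start by rewrite pub1.
by case/andP: (solution_in_X2 p_sol pW p_ub1).
Qed.


Lemma step_progress (c : config R S) :
  terminal c \/ exists c', step E c1 c2 start W X2 h1 h2 ub1 ub2 c c'.
Proof.
case: c => [[|y O] gm f1b fs sol []]; rewrite /terminal /=; try by left.
have [x x_open x_min] := exists_lexle_min
  (fun y => (nf1 c1 start h1 y, nf2 c2 start h2 y)) (isT : y :: O != [::]).
right; case: (ltP f1b (nf1 c1 start h1 x)%:E) => [f1_gt|f1_le].
  by eexists; apply: step_stop x_open x_min f1_gt.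
case: (leP (gm (nstate start x)) (ng2 c2 start x)%:E) => [dead|live].
  by eexists; apply: step_discard x_open x_min f1_le dead.
case upd: (early_update c1 c2 start W h1 ub1 ub2 x f1b fs sol) => [[f1b' fs'] sol'].
by eexists; apply: step_process x_open x_min f1_le live upd.
Qed.

Section Search.
Variable ps : seq S.
Hypothesis ps_opt : cost_optimal E c1 c2 start goal W ps.

Local Notation opt1 := (pcost c1 start ps).
Local Notation opt2 := (pcost c2 start ps).
Local Notation st := (nstate start).
Local Notation g1 := (ng1 c1 start).
Local Notation g2 := (ng2 c2 start).
Local Notation f1 := (nf1 c1 start h1).
Local Notation f2 := (nf2 c2 start h2).
Local Notation f2ub y := (g2 y + ub2 (st y)).
Local Notation cfg := (config R S).
Local Notation step := (step E c1 c2 start W X2 h1 h2 ub1 ub2).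

Lemma opt1_min q : gpath E setT start q goal -> pcost c2 start q <= W ->
  opt1 <= pcost c1 start q.
Proof. by case: ps_opt => _ _ ps_min q_sol qW; apply: lexle_le1 (ps_min q q_sol qW). Qed.

Lemma opt2_le_W : opt2 <= W.
Proof. by case: ps_opt. Qed.

Lemma opt1_le_ub1 : opt1 <= ub1 start.
Proof. by have [p [p_sol pW <-]] := start_solution; apply: opt1_min. Qed.

(* [r] is explicit because its length is the induction measure of
   [process_good_x]. *)
Definition good (y r : seq S) : Prop :=
  [/\ path E start y, gpath E setT (st y) r goal,
      g1 y + pcost c1 (st y) r <= opt1 & g2 y + pcost c2 (st y) r <= opt2].

Definition live (c : cfg) (y : seq S) : bool := ((g2 y)%:E < cgmin c (st y))%E.

Definition sol_optimal (c : cfg) : Prop := exists s,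
  [/\ cSol c = Some s, path E start s, f2ub s <= W &
      lexle (f1 s, f2ub s) (opt1, opt2)].

(* Either [Sol] was set together with the current bound, or the bound was
   later lowered through an [ub1]-update, which resets [f2sol]. *)
Definition sol_inv (c : cfg) : Prop :=
  (cSol c = None /\ cfsol2 c = +oo%E) \/ exists s,
  [/\ cSol c = Some s, path E start s, f2ub s <= W &
      (cf1b c = (f1 s)%:E /\ cfsol2 c = (f2ub s)%:E) \/
      (cfsol2 c = +oo%E /\ (cf1b c < (f1 s)%:E)%E)].

Definition f1bar_inv (c : cfg) : Prop := exists2 t, cf1b c = t%:E & opt1 <= t.

(* The last clause is what keeps open nodes simple paths. *)
Definition open_inv (c : cfg) : Prop := forall y, y \in cOpen c ->
  [/\ path E start y, st y \in X2, f2 y <= W, uniq (start :: y) &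
      forall i, (i < size y)%N -> (cgmin c (st (take i y)) <= (g2 (take i y))%:E)%E].

(* [H] lists the nodes expanded so far. *)
Record closed_inv (c : cfg) (H : seq (seq S)) : Prop := ClosedInv {
  closed_gmin : forall v, cgmin c v = +oo%E \/
    exists2 z, z \in H & st z = v /\ cgmin c v = (g2 z)%:E;
  closed_path : forall z, z \in H -> path E start z;
  closed_f1_le : forall z w : seq S, z \in H -> w \in cOpen c -> f1 z <= f1 w;
  closed_good : ~ sol_optimal c -> forall z r, z \in H -> good z r ->
    exists (w : seq S) r', [/\ w \in cOpen c, live c w, good w r' & (size r' < size r)%N] }.

Record inv (c : cfg) : Prop := Inv {
  inv_sol : sol_inv c;
  inv_f1bar : f1bar_inv c;
  inv_open : open_inv c;
  inv_closed : exists H, closed_inv c H;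
  inv_frontier : ~ sol_optimal c ->
    exists (w : seq S) r, [/\ w \in cOpen c, live c w & good w r];
  inv_halted : chalted c -> sol_optimal c }.

Lemma good_in_X2 y r : good y r -> all (mem X2) (start :: y ++ r).
Proof.
case=> Ey r_sol le1 le2; apply: solution_in_X2; first exact: gpath_catT.
  by rewrite pcost_cat (le_trans le2) ?opt2_le_W.
by rewrite pcost_cat (le_trans le1) ?opt1_le_ub1.
Qed.

Lemma good_X1_path y r : good y r -> gpath E X1 (st y) r goal.
Proof.
case=> Ey r_sol _ le2; apply: solution_suffix_in_X1 => //.
by rewrite pcost_cat (le_trans le2) ?opt2_le_W.
Qed.

Lemma good_lexle_opt y r : good y r -> lexle (f1 y, f2ub y) (opt1, opt2).
Proof.
move=> Gy; have h1_le := h1_min (good_X1_path Gy); case: Gy => Ey r_sol le1 le2.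
have f1_le : f1 y <= opt1 by apply: le_trans le1; rewrite lerD2l.
apply: lexleI => //= f1_eq.
have yrW : pcost c2 start (y ++ r) <= W by rewrite pcost_cat (le_trans le2) ?opt2_le_W.
apply: le_trans le2; rewrite lerD2l; apply: ub2_le_suffix => //.
by apply/eqP; rewrite eq_le h1_le andbT -(lerD2l (g1 y)) -[_ + h1 _]/(f1 y) f1_eq.
Qed.

Lemma good_f1_le y r : good y r -> f1 y <= opt1.
Proof. by move/good_lexle_opt/lexle_le1. Qed.

Lemma st_rcons x v : st (rcons x v) = v.
Proof. exact: last_rcons. Qed.

Lemma g1_rcons x v : g1 (rcons x v) = g1 x + c1 (st x) v.
Proof. exact: pcost_rcons. Qed.

Lemma g2_rcons x v : g2 (rcons x v) = g2 x + c2 (st x) v.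
Proof. exact: pcost_rcons. Qed.

Lemma good_rcons x v r : good x (v :: r) ->
  [/\ E (st x) v, v \in X2 & good (rcons x v) r].
Proof.
move=> Gx; have xrX2 := good_in_X2 Gx.
case: Gx => Ex /gpath_cons[Exv _ r_sol] le1 le2; split=> //.
  by apply: (allP xrX2); rewrite -cat_cons mem_cat mem_head orbT.
by split; rewrite ?st_rcons ?g1_rcons ?g2_rcons -?addrA // rcons_path Ex Exv.
Qed.

Lemma f1_rcons_ge x v : st x \in X1 -> v \in X2 -> E (st x) v -> f1 x <= f1 (rcons x v).
Proof.
move=> xX1 vX2 Exv; rewrite /nf1 -/(g1 x) -/(g1 (rcons x v)) g1_rcons st_rcons.
by rewrite -addrA lerD2l h1_edge.
Qed.

Lemma gmin_updE gm x w :
  gmin_upd c2 start gm x w = if w == st x then (g2 x)%:E else gm w.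
Proof. by []. Qed.

Lemma inv_init : inv (init_config start X1 ub1).
Proof.
have ps_sol : gpath E setT start ps goal by case: ps_opt.
rewrite /init_config start_X1; split=> //=.
- by left.
- by exists (ub1 start); rewrite ?opt1_le_ub1.
- move=> y; rewrite mem_seq1 => /eqP -> /=; split=> //; first exact: start_X2.
  by rewrite /nf2 /ng2 /= add0r (le_trans (h2_min ps_sol)) ?opt2_le_W.
- by exists [::]; split=> // v; left.
- move=> _; exists [::], ps; split; rewrite ?mem_seq1 /live /= ?ltey //.
  by split; rewrite // /ng1 /ng2 /= add0r.
Qed.

Lemma stop_sol_optimal (c : cfg) x : inv c -> x \in cOpen c ->
  (forall y, y \in cOpen c -> lexle (f1 x, f2 x) (f1 y, f2 y)) ->
  (cf1b c < (f1 x)%:E)%E -> sol_optimal c.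
Proof.
case=> _ [t -> opt_t] _ _ frontier _ x_open x_min; rewrite lte_fin => t_lt.
apply: NNPP => notA; have [w [r [w_open _ Gw]]] := frontier notA.
have := le_lt_trans (le_trans (lexle_le1 (x_min w w_open)) (good_f1_le Gw)) (le_lt_trans opt_t t_lt).
by rewrite ltxx.
Qed.

Lemma inv_stop O gm f1b fs sol x :
  inv (Config O gm f1b fs sol false) -> x \in O ->
  (forall y, y \in O -> lexle (f1 x, f2 x) (f1 y, f2 y)) ->
  (f1b < (f1 x)%:E)%E -> inv (Config (rem x O) gm f1b fs sol true).
Proof.
move=> Ic x_open x_min f1_gt; have A := stop_sol_optimal Ic x_open x_min f1_gt.
case: Ic => sinv finv oinv [H [cgmin cpath cf1 cgood]] _ _.
split=> //=; first by move=> y /mem_rem; apply: oinv.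
by exists H; split=> // z w z_closed /mem_rem; apply: cf1.
Qed.

Lemma inv_discard O gm f1b fs sol x :
  inv (Config O gm f1b fs sol false) -> x \in O -> (gm (st x) <= (g2 x)%:E)%E ->
  inv (Config (rem x O) gm f1b fs sol false).
Proof.
case=> sinv finv oinv [H [cgmin cpath cf1 cgood]] frontier _ x_open x_dead.
have live_rem w : w \in O -> live (Config O gm f1b fs sol false) w -> w \in rem x O.
  move=> w_open w_live; apply: rem_mem => //; apply: contraTneq w_live => ->.
  by rewrite /live -leNgt.
split=> //=.
- by move=> y /mem_rem; apply: oinv.
- exists H; split=> //= [z w z_closed /mem_rem|notA z r z_closed Gz]; first exact: cf1.
  have [w [r' [w_open w_live Gw lt_r']]] := cgood notA z r z_closed Gz.
  by exists w, r'; rewrite live_rem.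
- move=> notA; have [w [r [w_open w_live Gw]]] := frontier notA.
  by exists w, r; rewrite live_rem.
Qed.

Section Process.
Variables (O : seq (seq S)) (gm : S -> \bar R) (f1b fs : \bar R)
  (sol : option (seq S)) (x : seq S) (f1b' fs' : \bar R) (sol' : option (seq S)).
Local Notation c := (Config O gm f1b fs sol false).
Hypothesis c_inv : inv c.
Hypothesis x_open : x \in O.
Hypothesis x_min : forall y, y \in O -> lexle (f1 x, f2 x) (f1 y, f2 y).
Hypothesis x_f1b : ((f1 x)%:E <= f1b)%E.
Hypothesis x_live : ((g2 x)%:E < gm (st x))%E.
Hypothesis x_update :
  early_update c1 c2 start W h1 ub1 ub2 x f1b fs sol = (f1b', fs', sol').
Local Notation gm' := (gmin_upd c2 start gm x).
Local Notation kids := (children E c1 c2 start W X2 h1 h2 gm' f1b' x).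
Local Notation O' := (if h1 (st x) == ub1 (st x) then rem x O else rem x O ++ kids).
Local Notation c' := (Config O' gm' f1b' fs' sol' false).

Lemma x_open_inv : [/\ path E start x, st x \in X2, f2 x <= W, uniq (start :: x) &
  forall i, (i < size x)%N -> (gm (st (take i x)) <= (g2 (take i x))%:E)%E].
Proof. by case: c_inv => _ _ oinv _ _ _; apply: oinv. Qed.

Lemma process_sol_inv : sol_inv c'.
Proof.
case: c_inv => sinv _ _ _ _ _; have [Ex _ _ _ _] := x_open_inv.
move: x_update; rewrite /early_update.
case: ifP => x_W; case: ifP => lower [<- <- <-] //.
  by right; exists x; split=> //; left.
case: sinv => /= [[-> _]|[s [-> Es sW bound]]]; first by left.
right; exists s; split=> //=; right; split=> //.
by case: bound => [[/= <- _]|[_ /= s_lt]] //; apply: lt_trans s_lt.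
Qed.

Lemma process_f1bar_inv : f1bar_inv c'.
Proof.
case: c_inv => _ [t /= f1bE opt_t] _ _ _ _; have [Ex xX2 xW _ _] := x_open_inv.
move: x_update; rewrite /early_update.
case: ifP => x_W; case: ifP => _ [<- _ _]; try by exists t.
  exists (f1 x) => //; have [p p_sol [h1E ub2E]] := X2_h1_path xX2.
  have := opt1_min (gpath_catT Ex (gpath_setT p_sol)).
  by rewrite !pcost_cat -/(st x) -h1E -ub2E; apply.
exists (g1 x + ub1 (st x)) => //; have [p p_sol [h2E ub1E]] := X2_h2_path xX2.
have := opt1_min (gpath_catT Ex p_sol).
by rewrite !pcost_cat -/(st x) -h2E -ub1E; apply.
Qed.

Lemma process_sol_optimal_mono : sol_optimal c -> sol_optimal c'.
Proof.
case: c_inv => sinv _ _ _ _ _ [s [/= sol_s Es sW s_opt]].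
move: x_update; rewrite /early_update.
have keep : sol = sol' -> sol_optimal c' by move=> <-; exists s.
case: ifP => x_W; last by case: ifP => _ [_ _]; apply: keep.
case: ifP => lower [_ _ sol'E]; last exact: keep.
have [Ex _ _ _ _] := x_open_inv.
exists x; split=> //; apply: lexle_trans s_opt.
case: sinv => /= [[sol0 _]|[s' [sol_s' _ _ bound]]]; first by rewrite sol_s in sol0.
have s'E : s' = s by move: sol_s'; rewrite sol_s => -[].
rewrite {s' sol_s'}s'E in bound.
case: bound => [[f1bE fsE]|[fsE f1b_lt]].
  move: lower x_f1b; rewrite f1bE fsE !lte_fin lee_fin => /orP[lt1 _|lt2 le1].
    by apply: lexleI => [|/= eq1]; [exact: ltW | rewrite eq1 ltxx in lt1].
  by apply: lexleI => // _; exact: ltW.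
have := le_lt_trans x_f1b f1b_lt; rewrite lte_fin => lt1.
by apply: lexleI => [|/= eq1]; [exact: ltW | rewrite eq1 ltxx in lt1].
Qed.

Lemma process_sol_optimal :
  f2ub x <= W -> lexle (f1 x, f2ub x) (opt1, opt2) -> sol_optimal c'.
Proof.
move=> x_W x_opt; case: c_inv => sinv _ _ _ _ _; have [Ex _ _ _ _] := x_open_inv.
move: x_update; rewrite /early_update x_W.
case: ifP => lower [_ _ sol'E]; first by exists x; rewrite /= -sol'E.
case: sinv => /= [[_ fs_oo]|[s [sol_s Es sW bound]]].
  by rewrite fs_oo ltey orbT in lower.
case: bound => [[f1bE fsE]|[fs_oo _]]; last by rewrite fs_oo ltey orbT in lower.
exists s; split=> //; first by rewrite /= -sol'E.
apply: lexle_trans x_opt.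
move: lower x_f1b; rewrite f1bE fsE !lte_fin lee_fin => /norP[ge1 ge2] le1.
have eq1 : f1 s = f1 x by apply/eqP; rewrite eq_le le1 leNgt ge1.
by apply: lexleI => [|_]; rewrite /= ?eq1 // leNgt.
Qed.

Lemma gmin_upd_le w : (gm' w <= gm w)%E.
Proof. by rewrite gmin_updE; case: eqP => [->|_] //; apply: ltW. Qed.

Lemma gmin_upd_x : gm' (st x) = (g2 x)%:E.
Proof. by rewrite gmin_updE eqxx. Qed.

Lemma gmin_upd_prefix i : (i <= size x)%N ->
  (gm' (st (take i x)) <= (g2 (take i x))%:E)%E.
Proof.
have [_ _ _ _ x_prefix] := x_open_inv.
rewrite leq_eqVlt => /orP[/eqP ->|lt_ix]; first by rewrite take_size gmin_upd_x.
exact: le_trans (gmin_upd_le _) (x_prefix i lt_ix).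
Qed.

Lemma mem_children y : y \in kids <-> exists v, y = rcons x v /\
  [&& E (st x) v, v \in X2, ((g2 (rcons x v))%:E < gm' v)%E,
      ((f1 (rcons x v))%:E <= f1b')%E & f2 (rcons x v) <= W].
Proof.
split; first by case/mapP => v; rewrite mem_filter => /andP[? _] ->; exists v.
by case=> v [-> kid_v]; apply: map_f; rewrite mem_filter kid_v mem_enum.
Qed.

(* A child extending [x] by a state already on [x] would not improve the
   [g_min] recorded there, since costs are nonnegative. *)
Lemma child_uniq v : E (st x) v -> ((g2 (rcons x v))%:E < gm' v)%E ->
  uniq (start :: rcons x v).
Proof.
have [Ex _ _ xU _] := x_open_inv; move=> Exv kid_live.
rewrite -rcons_cons rcons_uniq xU andbT; apply/negP => /mem_path_last_take[i le_ix vE].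
move: kid_live; rewrite ltNge -{1}vE => /negP; apply.
apply: le_trans (gmin_upd_prefix le_ix) _; rewrite lee_fin g2_rcons.
by apply: le_trans (pcost_take_le i c2_ge0 Ex) _; rewrite lerDl c2_ge0.
Qed.

Lemma process_open_inv : open_inv c'.
Proof.
have [Ex _ _ _ _] := x_open_inv.
have old y : y \in rem x O -> [/\ path E start y, st y \in X2, f2 y <= W,
    uniq (start :: y) & forall i, (i < size y)%N ->
      (gm' (st (take i y)) <= (g2 (take i y))%:E)%E].
  move/mem_rem => y_open; case: c_inv => _ _ oinv _ _ _.
  have [? ? ? ? y_prefix] := oinv y y_open; split=> // i lt_iy.
  exact: le_trans (gmin_upd_le _) (y_prefix i lt_iy).
move=> y /=; case: ifP => _; first exact: old.
rewrite mem_cat => /orP[/old //|/mem_children[v [-> /and5P[Exv vX2 kid_live _ kidW]]]].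
split=> //; [by rewrite rcons_path Ex | by rewrite st_rcons | exact: child_uniq |].
move=> i; rewrite size_rcons ltnS => le_ix.
by rewrite -cats1 takel_cat // gmin_upd_prefix.
Qed.

(* Expanding [x] lowers [g_min] only at [st x]; an open node there that it
   kills has [g2] no smaller and, by the choice of [x], [f1] no smaller. *)
Lemma process_live_good w r : w \in O -> live c w -> good w r ->
  (w \in O' /\ live c' w) \/ good x r.
Proof.
move=> w_open w_live Gw; case: (eqVneq w x) Gw => [-> | w_neq] Gw; first by right.
have w_open' : w \in O'.
  have w_rem : w \in rem x O by rewrite rem_mem.
  by case: ifP => _; rewrite ?mem_cat w_rem.
have [st_eq|st_neq] := eqVneq (st w) (st x); last first.
  by left; split=> //; rewrite /live /= gmin_updE (negbTE st_neq).
have [le_g2|lt_g2] := leP (g2 x) (g2 w); last first.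
  by left; split=> //; rewrite /live /= gmin_updE st_eq eqxx lte_fin.
have le_g1 : g1 x <= g1 w.
  by have := lexle_le1 (x_min w_open); rewrite /= /nf1 st_eq lerD2r.
right; have [Ex _ _ _ _] := x_open_inv; case: Gw => _ r_sol le1 le2.
by split; rewrite -?st_eq // ?(le_trans _ le1) ?(le_trans _ le2) ?lerD2r.
Qed.

Lemma good_x_f2ub_gt r : ~ sol_optimal c' -> good x r -> W < f2ub x.
Proof.
move=> notA' Gx; rewrite ltNge; apply/negP => xW; apply: notA'.
exact: process_sol_optimal xW (good_lexle_opt Gx).
Qed.

Lemma good_x_nonnil r : ~ sol_optimal c' -> good x r -> r != [::].
Proof.
move=> notA' Gx; apply: contraTneq (good_x_f2ub_gt notA' Gx) => r0; subst r.
have [Ex xX2 _ _ _] := x_open_inv; case: (Gx) => _ x_sol _ le2.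
have h1_0 : h1 (st x) = 0.
  by apply/eqP; rewrite eq_le h1_ge0 // (h1_min (good_X1_path Gx)).
rewrite -leNgt (le_trans _ opt2_le_W) // (le_trans _ le2) // lerD2l.
apply: ub2_le_suffix => //.
by rewrite pcost_cat (le_trans le2) ?opt2_le_W.
Qed.

Lemma h1_neq_ub1 r : ~ sol_optimal c' -> good x r -> h1 (st x) != ub1 (st x).
Proof.
move=> notA' Gx; have [Ex xX2 xW _ _] := x_open_inv; apply/eqP => h1E.
have [p p_sol [h2E ub1E]] := X2_h2_path xX2.
have := good_x_f2ub_gt notA' Gx; rewrite ltNge => /negP; apply.
apply: le_trans (xW); rewrite /nf2 lerD2l h2E; apply: ub2_le_suffix => //.
  by rewrite pcost_cat -/(st x) -h2E.
by rewrite h1E ub1E.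
Qed.

Lemma good_child_open v r : ~ sol_optimal c' -> good x (v :: r) ->
  ((g2 (rcons x v))%:E < gm' v)%E -> rcons x v \in O'.
Proof.
move=> notA' Gx kid_live; have [Exv vX2 Gy] := good_rcons Gx.
rewrite (negbTE (h1_neq_ub1 notA' Gx)) mem_cat; apply/orP; right.
apply/mem_children; exists v; split=> //; rewrite Exv vX2 kid_live /=.
case: process_f1bar_inv => t /= -> opt_t; rewrite lee_fin (le_trans (good_f1_le Gy)) //=.
case: Gy => _ r_sol _ le2; rewrite st_rcons in r_sol le2.
by rewrite (le_trans _ opt2_le_W) // (le_trans _ le2) // /nf2 st_rcons lerD2l h2_min.
Qed.

Lemma dominated_child_good H v r : closed_inv c H -> good (rcons x v) r ->
  v \in X2 -> E (st x) v -> v != st x -> (gm v <= (g2 (rcons x v))%:E)%E ->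
  exists2 z, z \in H & good z r.
Proof.
case=> cgmin cpath cf1 _ Gy vX2 Exv v_neq dead; have [_ xX2 _ _ _] := x_open_inv.
case: (cgmin v) => /= [gm_oo|[z z_closed [zv gmE]]]; first by rewrite gm_oo in dead.
have le_g2 : g2 z <= g2 (rcons x v) by rewrite gmE lee_fin in dead.
have le_f1 : f1 z <= f1 (rcons x v).
  exact: le_trans (cf1 z x z_closed x_open) (f1_rcons_ge (X2_sub_X1 xX2) vX2 Exv).
have le_g1 : g1 z <= g1 (rcons x v) by move: le_f1; rewrite /nf1 zv st_rcons lerD2r.
exists z => //; case: Gy => _; rewrite st_rcons => r_sol le1 le2.
by split; rewrite ?zv ?cpath // ?(le_trans _ le1) ?(le_trans _ le2) ?lerD2r.
Qed.

Lemma process_good_step r : ~ sol_optimal c' -> good x r ->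
  (exists2 r', good x r' & (size r' < size r)%N) \/
  exists w r', [/\ w \in O', live c' w, good w r' & (size r' < size r)%N].
Proof.
move=> notA' Gx; have notA : ~ sol_optimal c by move/process_sol_optimal_mono.
have [_ _ _ [H Hc] _ _] := c_inv; have [Ex _ _ _ _] := x_open_inv.
case: r Gx (good_x_nonnil notA' Gx) => // v r Gx _; have [Exv vX2 Gy] := good_rcons Gx.
have [kid_live|dead] := ltP (g2 (rcons x v))%:E (gm' v).
  right; exists (rcons x v), r; split=> //; first exact: good_child_open notA' Gx kid_live.
  by rewrite /live /= st_rcons.
have [vE|v_neq] := eqVneq v (st x).
  left; exists r => //; case: Gy => _; rewrite st_rcons g1_rcons g2_rcons vE.
  move=> r_sol le1 le2; rewrite vE in Exv.
  by split; rewrite // ?(le_trans _ le1) ?(le_trans _ le2) // lerD2r lerDl ?c1_ge0 ?c2_ge0.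
rewrite gmin_updE (negbTE v_neq) in dead.
have [z z_closed Gz] := dominated_child_good Hc Gy vX2 Exv v_neq dead.
have [w [r' [w_open w_live Gw lt_r']]] := closed_good Hc notA z_closed Gz.
have lt_r'r : (size r' < size (v :: r))%N by rewrite ltnW.
case: (process_live_good w_open w_live Gw) => [[w_open' w_live']|Gx'].
  by right; exists w, r'.
by left; exists r'.
Qed.

Lemma process_good_x r : ~ sol_optimal c' -> good x r ->
  exists w r', [/\ w \in O', live c' w, good w r' & (size r' < size r)%N].
Proof.
move=> notA'; have [n] := ubnP (size r); elim: n r => // n IH r.
rewrite ltnS => le_rn Gx; case: (process_good_step notA' Gx) => // -[r' Gx' lt_r'].
have [w [r'' [w_open w_live Gw lt_r'']]] := IH r' (leq_trans lt_r' le_rn) Gx'.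
by exists w, r''; split=> //; apply: ltn_trans lt_r'.
Qed.

Lemma f1_x_le_open' w : w \in O' -> f1 x <= f1 w.
Proof.
have [_ xX2 _ _ _] := x_open_inv.
have x_le_rem y : y \in rem x O -> f1 x <= f1 y by move/mem_rem/x_min/lexle_le1.
case: ifP => _; first exact: x_le_rem.
rewrite mem_cat => /orP[/x_le_rem //|/mem_children[v [-> /and5P[Exv vX2 _ _ _]]]].
by rewrite f1_rcons_ge ?X2_sub_X1.
Qed.

Lemma process_inv : inv c'.
Proof.
have [_ _ _ [H Hc] frontier _] := c_inv; have [Ex _ _ _ _] := x_open_inv.
have notA_mono : ~ sol_optimal c' -> ~ sol_optimal c.
  by move=> notA' /process_sol_optimal_mono.
have rescue w r : ~ sol_optimal c' -> w \in O -> live c w -> good w r ->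
    exists w' r', [/\ w' \in O', live c' w', good w' r' & (size r' <= size r)%N].
  move=> notA' w_open w_live Gw.
  case: (process_live_good w_open w_live Gw) => [[w_open' w_live']|Gx].
    by exists w, r.
  have [w' [r' [? ? ? /ltnW]]] := process_good_x notA' Gx; by exists w', r'.
split=> //; [exact: process_sol_inv | exact: process_f1bar_inv
            | exact: process_open_inv | exists (x :: H); split | ].
- move=> v /=; rewrite gmin_updE; case: eqP => [->|_].
    by right; exists x; rewrite ?mem_head.
  case: (closed_gmin Hc v) => /= [->|[z z_closed zE]]; first by left.
  by right; exists z; rewrite // in_cons z_closed orbT.
- by move=> z; rewrite in_cons => /orP[/eqP ->|/(closed_path Hc)].
- move=> z w; rewrite in_cons => /orP[/eqP ->|z_closed] w_open'.
    exact: f1_x_le_open'.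
  exact: le_trans (closed_f1_le Hc z_closed x_open) (f1_x_le_open' w_open').
- move=> notA' z r; rewrite in_cons => /orP[/eqP ->|z_closed] Gz.
    exact: process_good_x.
  have [w [r' [w_open w_live Gw lt_r']]] := closed_good Hc (notA_mono notA') z_closed Gz.
  have [w' [r'' [? ? ? le_r'']]] := rescue w r' notA' w_open w_live Gw.
  by exists w', r''; split=> //; apply: leq_ltn_trans lt_r'.
- move=> notA'; have [w [r [w_open w_live Gw]]] := frontier (notA_mono notA').
  by have [w' [r' [? ? ? _]]] := rescue w r notA' w_open w_live Gw; exists w', r'.
Qed.

End Process.

Lemma inv_step (c c' : cfg) : inv c -> step c c' -> inv c'.
Proof.
move=> Ic c_step; case: c_step Ic => O gm f1b fs sol x.
- by move=> x_open x_min f1_gt Ic; apply: inv_stop.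
- by move=> x_open _ _ dead Ic; apply: inv_discard.
- move=> f1b' fs' sol' x_open x_min x_f1b x_live x_update Ic.
  exact: (process_inv Ic x_open x_min x_f1b x_live x_update).
Qed.

Lemma reachable_inv (c : cfg) :
  reachable E c1 c2 start W X1 X2 h1 h2 ub1 ub2 c -> inv c.
Proof. by elim=> [|c0 c' _ Ic0 /(inv_step Ic0)]; [apply: inv_init|]. Qed.

Lemma terminal_sol_optimal (c : cfg) : inv c -> terminal c -> sol_optimal c.
Proof.
case=> _ _ _ _ frontier halted /orP[/halted //|O0].
apply: NNPP => /frontier[w [r [w_open _ _]]].
by move: O0 w_open; case: (cOpen c).
Qed.

Lemma terminal_cost_optimal (c : cfg) :
  reachable E c1 c2 start W X1 X2 h1 h2 ub1 ub2 c -> terminal c ->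
  exists2 s, cSol c = Some s & forall q, gpath E setT (st s) q goal ->
    pcost c1 (st s) q = h1 (st s) -> pcost c2 (st s) q = ub2 (st s) ->
    cost_optimal E c1 c2 start goal W (s ++ q).
Proof.
move=> /reachable_inv Ic /(terminal_sol_optimal Ic)[s [sol_s Es sW s_opt]].
exists s => // q q_sol q1 q2; case: ps_opt => _ _ ps_min.
have c1E : pcost c1 start (s ++ q) = f1 s by rewrite pcost_cat -/(st s) q1.
have c2E : pcost c2 start (s ++ q) = f2ub s by rewrite pcost_cat -/(st s) q2.
split; [exact: gpath_catT | by rewrite c2E | move=> q' q'_sol q'W].
by rewrite c1E c2E; apply: lexle_trans s_opt (ps_min q' q'_sol q'W).
Qed.

Definition live_count (c : cfg) : nat := count (live c) (seqs_upto S #|S|).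

Lemma step_measure (c c' : cfg) : inv c -> step c c' -> ~~ chalted c' ->
  (live_count c' < live_count c \/
   live_count c' <= live_count c /\ size (cOpen c') < size (cOpen c))%N.
Proof.
move=> Ic c_step; case: c_step Ic => //= O gm f1b fs sol x.
  move=> x_open _ _ _ _ _; right; split=> //.
  by rewrite size_rem // prednK // -has_predT; apply/hasP; exists x.
move=> f1b' fs' sol' x_open _ _ x_live _ Ic _; left.
have [_ _ _ xU _] := inv_open Ic x_open.
apply: (@count_lt_subpred _ _ _ _ x).
- move=> y; rewrite /live /= gmin_updE; case: eqP => [->|_] // y_live.
  exact: lt_trans y_live x_live.
- by rewrite mem_seqs_upto // ltnW // (uniq_path_size_lt_card xU).
- exact: x_live.
- by rewrite /live /= gmin_updE eqxx ltxx.
Qed.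

Lemma no_infinite_run : ~ exists run : nat -> cfg,
  run 0%N = init_config start X1 ub1 /\ forall n, step (run n) (run n.+1).
Proof.
case=> run [run0 run_step].
have run_inv n : inv (run n).
  by elim: n => [|n IH]; [rewrite run0; apply: inv_init | apply: inv_step (run_step n)].
apply: (@no_lex_descent (fun n => live_count (run n)) (fun n => size (cOpen (run n)))).
move=> n; apply: step_measure (run_inv n) (run_step n) _.
by case: (run_step n.+1).
Qed.

End Search.

End Instance.

Unset Implicit Arguments.

Theorem theorem3 (R : realDomainType) (S : finType) (E : rel S)
    (c1 c2 : S -> S -> R) (start goal : S) (W : R)
    (* non-negative edge costs *)
    (Hc1 : forall u v, E u v -> 0 <= c1 u v)
    (Hc2 : forall u v, E u v -> 0 <= c2 u v)
    (* the instance has a solution path *)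
    (Hfeas : exists p, gpath E setT start p goal /\ pcost c2 start p <= W)
    (* heuristics of the two backward searches (they estimate the cost from
       start): admissible and consistent *)
    (hh2 hh1 : S -> R)
    (Hhh2_adm : forall u p, gpath E setT start p u -> hh2 u <= pcost c2 start p)
    (Hhh2_cons : forall u v, E u v -> hh2 v <= hh2 u + c2 u v)
    (* results of the initialisation phase *)
    (X1 X2 : {set S}) (h1 h2 ub1 ub2 : S -> R)
    (Hhh1_adm : forall u p, gpath E X1 start p u -> hh1 u <= pcost c1 start p)
    (Hhh1_cons : forall u v, u \in X1 -> v \in X1 -> E u v ->
                   hh1 v <= hh1 u + c1 u v)
    (Hinit : init_outcome E c1 c2 start goal W hh2 hh1 X1 X2 h1 h2 ub1 ub2) :
  (* WC-A* terminates: no infinite run, and it never gets stuck *)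
  (~ exists run : nat -> config R S,
       run 0%N = init_config start X1 ub1 /\
       forall n, step E c1 c2 start W X2 h1 h2 ub1 ub2 (run n) (run n.+1)) /\
  (forall c, reachable E c1 c2 start W X1 X2 h1 h2 ub1 ub2 c ->
     terminal c \/ exists c', step E c1 c2 start W X2 h1 h2 ub1 ub2 c c') /\
  (* when it terminates, Sol yields a cost-optimal solution path *)
  (forall c, reachable E c1 c2 start W X1 X2 h1 h2 ub1 ub2 c -> terminal c ->
     exists2 x, cSol c = Some x &
       forall q, gpath E setT (nstate start x) q goal ->
         pcost c1 (nstate start x) q = h1 (nstate start x) ->
         pcost c2 (nstate start x) q = ub2 (nstate start x) ->
         cost_optimal E c1 c2 start goal W (x ++ q)).
Proof.
have [ps ps_opt] := exists_cost_optimal Hc1 Hc2 Hfeas.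
split; first exact: (no_infinite_run Hc1 Hc2 Hfeas Hhh2_adm Hhh1_adm Hinit ps_opt).
split; first by move=> c _; apply: step_progress.
exact: (terminal_cost_optimal Hc1 Hc2 Hfeas Hhh2_adm Hhh1_adm Hinit ps_opt).
Qed.
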